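(* Let $(M,\mathcal{F})$ be a foliated manifold. There is a morphism $H(\mathcal{D}_{\mathcal{F}})\to H_b(M,\mathcal{F})$ between the De Rham cohomology $H(\mathcal{D}_{\mathcal{F}})$ of the leaf space $M/\mathcal{F}$, endowed with the quotient diffeology $\mathcal{D}_{\mathcal{F}}$, and the basic cohomology $H_b(M,\mathcal{F})$ of the foliation.
   Context: A plot on a set $X$ is a map $\alpha\colon U\to X$ defined on an open subset $U$ of some $\mathbb{R}^n$, $n\ge 0$. A diffeology of class $C^\infty$ on $X$ is a family $\mathcal{D}$ of plots such that: (1) all constant plots are in $\mathcal{D}$; (2) if $\alpha\in\mathcal{D}$ is defined on $U\subset\mathbb{R}^n$ and $h\colon V\subset\mathbb{R}^m\to U$ is any $C^\infty$ map ($V$ open), then $\alpha\circ h\in\mathcal{D}$; (3) if $\alpha\colon U\to X$ is a plot and each $t\in U$ has a neighbourhood $V\subset U$ with $\alpha|_V\in\mathcal{D}$, then $\alpha\in\mathcal{D}$. A diffeological space is a set endowed with a diffeology. A map $f\colon X\to Y$ between diffeological spaces $(X,\mathcal{D})$ and $(Y,\mathcal{E})$ is $\mathcal{D}$-differentiable if $f\circ\alpha\in\mathcal{E}$ for all $\alpha\in\mathcal{D}$. The $C^\infty$-diffeology on a $C^\infty$ manifold $M$ consists of all $C^\infty$ plots $\alpha\colon U\subset\mathbb{R}^n\to M$, $n\ge 0$. Let $(M,\mathcal{F})$ be a foliated manifold. The space of leaves $M/\mathcal{F}$ is the quotient of $M$ in which two points are identified iff they are on the same leaf of $\mathcal{F}$;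 let $\pi\colon M\to M/\mathcal{F}$ be the canonical projection. The quotient diffeology $\mathcal{D}_{\mathcal{F}}$ on $M/\mathcal{F}$ is the least diffeology such that $\pi$ is $\mathcal{D}$-differentiable when $M$ carries the $C^\infty$-diffeology. Explicitly, a plot $\alpha\colon U\subset\mathbb{R}^n\to M/\mathcal{F}$ belongs to $\mathcal{D}_{\mathcal{F}}$ iff every $t\in U$ has a neighbourhood $V_t$ such that $\alpha|_{V_t}=\pi\circ\beta_t$ for some $C^\infty$ map $\beta_t\colon V_t\to M$. For a diffeological space $(X,\mathcal{D})$, a $\mathcal{D}$-differential form of degree $r\ge 0$ is a family $\omega=\{\omega_\alpha\}_{\alpha\in\mathcal{D}}$, where $\omega_\alpha\in\Omega^r(U)$ is an $r$-form on the domain $U$ of $\alpha$, such that $\omega_{\alpha\circ h}=h^*\omega_\alpha$ for every $\alpha\in\mathcal{D}$ with domain $U$ and every $C^\infty$ map $h\colon V\subset\mathbb{R}^m\to U$. $\Omega^r(\mathcal{D})$ is the space of such forms, with exterior differential $d\omega=\{d\omega_\alpha\}_{\alpha\in\mathcal{D}}$. The De Rham cohomology $H(\mathcal{D})$ of $(X,\mathcal{D})$ is the cohomology of the complex $(\Omega(\mathcal{D}),d)$. A differential form $\omega\in\Omega^r(M)$ is basic if $i_X\omega=0$ and $i_Xd\omega=0$ for every vector field $X$ tangent to $\mathcal{F}$. The basic cohomology $H_b(M,\mathcal{F})$ is the cohomology of the complex $\Omega_b(M,\mathcal{F})$ of basic forms, endowed with the usual exterior differential of $M$. *)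

(* Defs.v *)
From HB Require Import structures.
From mathcomp Require Import all_boot all_order all_algebra.
From mathcomp Require Import all_classical all_reals all_analysis.
From Stdlib Require Import Relation_Operators.

Set Implicit Arguments.
Unset Strict Implicit.
Unset Printing Implicit Defensive.

Import Order.TTheory GRing.Theory Num.Theory numFieldNormedType.Exports.

Local Open Scope classical_set_scope.
Local Open Scope ring_scope.
Local Open Scope quotient_scope.

(* Functions on open subsets of R^n are total functions on 'rV[R]_n whose
   values outside the subset are irrelevant.  Vectors are rows, so that
   'd h x v = v *m 'J h x and an r-tuple of vectors is a matrix with r rows. *)

Lemma near_eq_diff (R : realType) (V W : normedModType R) (f g : V -> W) x :
  {near x, f =1 g} -> differentiable f x -> differentiable g x.
Proof.
move=> fg df; have gx := nbhs_singleton fg.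
have /diff_locallyP[dc /eqaddoP fe] := df.
have ge : g \o shift x = cst (g x) + 'd f x +o_ 0 id.
  apply/eqaddoP => e e0; have := fe e e0; apply: filter_app.
  have : \forall h \near (0 : V), f (h + x) = g (h + x).
    move: fg; rewrite (near_shift 0) /= subr0.
    by apply.
  apply: filter_app; near=> h => e1.
  by rewrite /= !fctE /= e1 gx.
have dE : 'd g x = 'd f x :> (V -> W) by exact: diff_unique.
by apply/diff_locallyP; rewrite dE.
Unshelve. all: by end_near. Qed.

Section Smooth.
Variables (R : realType) (n : nat).

(* U is open in every use, so the differential at a point of U only depends on
   f on U.  Differentiability gives continuity, so it is only required for k = 0. *)
Fixpoint Ck (W : normedModType R) (k : nat) (U : set 'rV[R]_n)
    (f : 'rV[R]_n -> W) : Prop :=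
  if k is k'.+1 then
    (forall x, U x -> differentiable f x) /\
    (forall v, Ck k' U (fun x => 'D_v f x))
  else forall x, U x -> {for x, continuous f}.

Definition smooth (W : normedModType R) (U : set 'rV[R]_n)
    (f : 'rV[R]_n -> W) : Prop := forall k, Ck k U f.

Section CkTheory.
Variable W : normedModType R.
Implicit Types (U V : set 'rV[R]_n) (f g : 'rV[R]_n -> W).

Lemma open_near_eq U f g x : open U -> (forall y, U y -> f y = g y) -> U x ->
  {near x, f =1 g}.
Proof.
move=> oU fg Ux; have : nbhs x U by exact: open_nbhs_nbhs.
by apply: filterS => y Uy; apply: fg.
Qed.

Lemma eq_Ck k U f g : open U -> (forall x, U x -> f x = g x) ->
  Ck k U f -> Ck k U g.
Proof.
move=> oU; elim: k f g => [|k IH] f g fg.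
  move=> fc x Ux; rewrite /prop_for /continuous_at -fg//.
  have fgx : {near x, f =1 g} by exact: open_near_eq fg Ux.
  exact: cvg_trans (near_eq_cvg fgx) (fc x Ux).
move=> [df Df]; split=> [x Ux|v].
  exact: near_eq_diff (open_near_eq oU fg Ux) (df x Ux).
apply: IH (Df v) => x Ux.
by apply: near_eq_derive; exact: open_near_eq fg Ux.
Qed.

Lemma CkS k U f : Ck k.+1 U f -> Ck k U f.
Proof.
elim: k f => [|k IH] f /= [df Df].
  by move=> x Ux; apply: differentiable_continuous; exact: df.
by split=> // v; apply: IH.
Qed.

Lemma Ck_diff k U f x : Ck k.+1 U f -> U x -> differentiable f x.
Proof. by move=> [df _]; exact: df. Qed.

Lemma sub_Ck k U V f : V `<=` U -> Ck k U f -> Ck k V f.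
Proof.
move=> VU; elim: k f => [|k IH] f /=; first by move=> fc x /VU /fc.
by move=> [df Df]; split=> [x /VU /df//|v]; exact: IH.
Qed.

Lemma Ck_cst k U (w : W) : Ck k U (cst w).
Proof.
elim: k w => [|k IH] w /=; first by move=> x _; exact: cst_continuous.
split=> [x _|v]; first exact: differentiable_cst.
rewrite (_ : (fun x => _) = cst 0); first exact: IH.
by apply/funext => x; rewrite derive_cst.
Qed.

Lemma Ck_lin k U (a : R) f g : open U -> Ck k U f -> Ck k U g ->
  Ck k U (fun x => a *: f x + g x).
Proof.
move=> oU; elim: k f g => [|k IH] f g /=.
  move=> fc gc x Ux; apply: (@continuousD _ _ _ (fun x => a *: f x)); last exact: gc.
  by apply: continuousZr; exact: fc.
move=> [df Df] [dg Dg]; split=> [x Ux|v].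
  exact: (differentiableD (differentiableZ a (df x Ux)) (dg x Ux)).
apply: eq_Ck oU _ (IH _ _ (Df v) (Dg v)) => x Ux.
have dfx := diff_derivable (v := v) (df x Ux).
have dgx := diff_derivable (v := v) (dg x Ux).
rewrite [RHS](deriveD (derivableZ (k:=a) dfx) dgx) deriveZ//.
Qed.

Lemma Ck_sum k U m (F : 'I_m -> 'rV[R]_n -> W) : open U ->
  (forall i, Ck k U (F i)) -> Ck k U (fun x => \sum_i F i x).
Proof.
move=> oU; elim: m F => [|m IH] F HF.
  by rewrite (_ : (fun x => _) = cst 0)//; [exact: Ck_cst|apply/funext => x; rewrite big_ord0].
apply: eq_Ck oU _ (Ck_lin 1 oU (HF ord0) (IH _ (fun i => HF (lift ord0 i)))) => x _.
by rewrite scale1r big_ord_recl.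
Qed.

Lemma Ck_local k U f : (forall x, U x -> exists V, [/\ open V, V x & Ck k (U `&` V) f]) ->
  Ck k U f.
Proof.
elim: k f => [|k IH] f H.
  by move=> x Ux; have [V [oV Vx HV]] := H x Ux; exact: HV.
split=> [x Ux|v]; first by have [V [oV Vx [HV _]]] := H x Ux; exact: HV.
by apply: IH => x /H [V [oV Vx [_ Df]]]; exists V; split=> //; exact: Df.
Qed.

End CkTheory.

Section scale.
Variable W : normedModType R.

Lemma scale_is_bilinear :
  bilinear_for
    (GRing.Scale.Law.clone _ _ *:%R _) (GRing.Scale.Law.clone _ _ *:%R _)
    (fun (a : R^o) (w : W) => a *: w).
Proof.
split=> [u'|u] a x y /=; first by rewrite scalerDl scalerA.
by rewrite scalerDr !scalerA [_ * a]mulrC.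
Qed.

Lemma is_diff_scale (p : R^o * W) :
  is_diff p (fun q => q.1 *: q.2) (fun q => p.1 *: q.2 + q.1 *: p.2).
Proof.
pose B : {bilinear R^o -> W -> W} := HB.pack (fun (a : R^o) (w : W) => a *: w)
  (bilinear_isBilinear.Build R R^o W W _ _ (fun (a : R^o) (w : W) => a *: w)
    scale_is_bilinear).
have cB : continuous (fun q : R^o * W => B q.1 q.2).
  by move=> q; apply: scale_continuous.
split; first exact: (differentiable_bilin _ cB).
exact: (diff_bilin _ cB).
Qed.

Lemma Ck_scale k (U : set 'rV[R]_n) (a : 'rV[R]_n -> R^o) (f : 'rV[R]_n -> W) :
  open U -> Ck k U a -> Ck k U f -> Ck k U (fun x => a x *: f x).
Proof.
move=> oU; elim: k a f => [|k IH] a f.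
  move=> ac fc x Ux; apply: continuousZ; [exact: ac|exact: fc].
move=> Ca Cf; have Ca' := CkS Ca; have Cf' := CkS Cf.
move: Ca Cf => [da Da] [df Df].
have H x : U x -> is_diff x (fun x => a x *: f x)
    (fun v => a x *: 'd f x v + 'd a x v *: f x).
  move=> Ux.
  have := is_diff_comp (is_diff_pair (differentiableP (da x Ux)) (differentiableP (df x Ux))) (is_diff_scale (a x, f x)).
  exact.
split=> [x /H[]//|v].
apply: eq_Ck oU _ (Ck_lin 1 oU (IH _ _ Ca' (Df v)) (IH _ _ (Da v) Cf')) => x Ux.
have [dx dE] := H _ Ux; rewrite [RHS]deriveE// dE scale1r -!deriveE//; exact: df || exact: da.
Qed.

End scale.
End Smooth.

Lemma Ck_linear (R : realType) n (W W' : normedModType R) k (U : set 'rV[R]_n)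
    (L : {linear W -> W'}) (f : 'rV[R]_n -> W) :
  open U -> continuous L -> Ck k U f -> Ck k U (L \o f).
Proof.
move=> oU cL; elim: k f => [|k IH] f /=.
  by move=> fc x Ux; apply: continuous_comp; [exact: fc|exact: cL].
move=> [df Df]; split=> [x Ux|v].
  by apply: differentiable_comp; [exact: df|exact: linear_differentiable].
apply: eq_Ck oU _ (IH _ (Df v)) => x Ux /=.
have dL : differentiable L (f x) by exact: linear_differentiable.
rewrite [RHS]deriveE; last by apply: differentiable_comp => //; exact: df.
by rewrite diff_comp//=; [rewrite diff_lin// deriveE//; exact: df|exact: df].
Qed.

Section comp.
Variables (R : realType) (m n : nat).

Lemma coord_lin (j : 'I_n) : linear (fun w : 'rV[R]_n => w 0 j : R^o).
Proof. by move=> a u v; rewrite !mxE. Qed.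

Lemma Ck_comp (W : normedModType R) k (V : set 'rV[R]_m) (U : set 'rV[R]_n)
    (h : 'rV[R]_m -> 'rV[R]_n) (f : 'rV[R]_n -> W) :
  open V -> (forall x, V x -> U (h x)) -> Ck k V h -> Ck k U f ->
  Ck k V (f \o h).
Proof.
move=> oV VU; elim: k f => [|k IH] f.
  move=> ch cf x Vx; apply: continuous_comp; [exact: ch|exact: cf (VU x Vx)].
move=> Ch Cf; have Ch' := CkS Ch; move: Ch Cf => [dh Dh] [df Df].
split=> [x Vx|v].
  by apply: differentiable_comp; [exact: dh|exact: df (VU _ Vx)].
pose G x := \sum_(j < n) ('D_v h x 0 j : R^o) *: ('D_(delta_mx 0 j) f \o h) x.
apply: (@eq_Ck _ _ _ _ _ G) => //.
  move=> x Vx; rewrite [RHS]deriveE; last first.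
    by apply: differentiable_comp; [exact: dh|exact: df (VU _ Vx)].
  rewrite diff_comp /=; [|exact: dh|exact: df (VU _ Vx)].
  rewrite -(deriveE _ (dh x Vx)) [in RHS](row_sum_delta ('D_v h x)) linear_sum.
  by apply: eq_bigr => j _; rewrite linearZ /= (@deriveE _ _ _ f)//; exact: df (VU _ Vx).
apply: Ck_sum => // j; apply: Ck_scale => //; last exact: (IH _ Ch' (Df _)).
pose L : {linear 'rV[R]_n -> R^o} := HB.pack (fun w : 'rV[R]_n => w 0 j : R^o)
  (GRing.isLinear.Build R _ R^o _ (fun w : 'rV[R]_n => w 0 j : R^o) (coord_lin j)).
apply: (@Ck_linear _ _ _ _ k V L _ oV _ (Dh v)).
exact: coord_continuous.
Qed.

Lemma smooth_comp (W : normedModType R) (V : set 'rV[R]_m) (U : set 'rV[R]_n)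
    (h : 'rV[R]_m -> 'rV[R]_n) (f : 'rV[R]_n -> W) :
  open V -> (forall x, V x -> U (h x)) -> smooth V h -> smooth U f ->
  smooth V (f \o h).
Proof. by move=> oV VU sh sf k; exact: Ck_comp (sh k) (sf k). Qed.
End comp.

(* The differential is only given on an ambient graded module.  For the de Rham
   and basic complexes below it preserves the cochains and squares to zero, but
   neither fact enters the formation of
     H^r = { z in C^r | d z = 0 } / { d y in this space | y in C^(r-1) }. *)
Record precomplex (K : pzRingType) := Precomplex {
  ambient : nat -> lmodType K;
  cochains : forall r, submodClosed (ambient r);
  differential : forall r, ambient r -> ambient r.+1;
  differential_linear : forall r a,
    {in cochains r &, forall u v,
      differential (a *: u + v) = a *: differential u + differential v} }.

Section Cohomology.
Variables (K : pzRingType) (C : precomplex K) (r : nat).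

Definition cocycle_pred : {pred ambient C r} :=
  [pred z | (z \in cochains C r) && (differential z == 0)].

Definition coboundary : set (ambient C r) :=
  match r return set (ambient C r) with
  | 0 => [set 0]
  | s.+1 => [set differential y | y in [set y | y \in cochains C s]]
  end.

Lemma cocycle_submod : submod_closed cocycle_pred.
Proof.
split=> [|a u v /andP[Cu /eqP du] /andP[Cv /eqP dv]].
  rewrite inE rpred0 /=.
  have := differential_linear (-1) (rpred0 (cochains C r)) (rpred0 (cochains C r)).
  by rewrite scaler0 addr0 scaleN1r addNr => ->.
by rewrite inE rpredD ?rpredZ //= differential_linear // du dv scaler0 addr0.
Qed.

HB.instance Definition _ :=
  GRing.isSubmodClosed.Build K (ambient C r) cocycle_pred cocycle_submod.

Record cocycle := Cocycle {
  cocycle_val : ambient C r;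
  cocycleP : cocycle_val \in cocycle_pred }.

HB.instance Definition _ := [isSub for cocycle_val].
HB.instance Definition _ := [Choice of cocycle by <:].
HB.instance Definition _ := [SubChoice_isSubLmodule of cocycle by <:].

Definition exact_pred : {pred cocycle} := fun z => `[< coboundary (val z) >].

Lemma coboundary_lin a u v : coboundary u -> coboundary v -> coboundary (a *: u + v).
Proof.
rewrite /coboundary; move: u v; case: r => [|s] u v /=.
  by move=> -> ->; rewrite scaler0 addr0.
move=> [x Cx <-] [y Cy <-]; exists (a *: x + y); last exact: differential_linear.
by rewrite /= rpredD ?rpredZ.
Qed.

Lemma coboundary0 : coboundary 0.
Proof.
rewrite /coboundary; case: r => [|s] //=; exists 0; first exact: rpred0.
have := differential_linear (-1) (rpred0 (cochains C s)) (rpred0 (cochains C s)).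
by rewrite scaler0 addr0 scaleN1r addNr => ->.
Qed.

Lemma exact_submod : submod_closed exact_pred.
Proof.
split=> [|a u v]; first by apply/asboolP; rewrite raddf0; exact: coboundary0.
move=> /asboolP eu /asboolP ev; apply/asboolP; rewrite linearP.
exact: coboundary_lin.
Qed.

HB.instance Definition _ :=
  GRing.isSubmodClosed.Build K cocycle exact_pred exact_submod.

Definition cohomology := Quotient.quot exact_pred.

HB.instance Definition _ := ZmodQuotient.on cohomology.

Definition coh_class (z : cocycle) : cohomology := \pi_cohomology z.

Definition coh_scale (a : K) (x : cohomology) : cohomology :=
  coh_class (a *: repr x).

Lemma coh_scaleE a z : coh_scale a (coh_class z) = coh_class (a *: z).
Proof.
apply/eqmodP; rewrite /= /Quotient.equiv -scalerBr rpredZ //.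
by rewrite Quotient.idealrBE reprK.
Qed.

Lemma coh_classD : {morph coh_class : x y / x + y}.
Proof. exact: raddfD. Qed.

Lemma coh_scaleA a b x : coh_scale a (coh_scale b x) = coh_scale (a * b) x.
Proof. by rewrite -[x]reprK -/(coh_class _) !coh_scaleE scalerA. Qed.

Lemma coh_scale1 : left_id 1 coh_scale.
Proof. by move=> x; rewrite -[x]reprK -/(coh_class _) coh_scaleE scale1r. Qed.

Lemma coh_scaleDr : right_distributive coh_scale +%R.
Proof.
move=> a x y; rewrite -[x]reprK -[y]reprK -!/(coh_class _).
by rewrite -coh_classD !coh_scaleE scalerDr coh_classD.
Qed.

Lemma coh_scaleDl x : {morph coh_scale^~ x : a b / a + b}.
Proof.
move=> a b; rewrite -[x]reprK -!/(coh_class _).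
by rewrite !coh_scaleE scalerDl coh_classD.
Qed.

HB.instance Definition _ := GRing.Zmodule_isLmodule.Build K cohomology
  coh_scaleA coh_scale1 coh_scaleDr coh_scaleDl.

End Cohomology.

Section Forms.
Variable R : realType.

Definition multilinear (r n : nat) (f : 'M[R]_(r, n) -> R) : Prop :=
  forall (i : 'I_r) (a b : R) (A B C : 'M[R]_(r, n)),
    row i A = a *: row i B + b *: row i C ->
    row' i B = row' i A -> row' i C = row' i A ->
    f A = a * f B + b * f C.

Definition alternating (r n : nat) (f : 'M[R]_(r, n) -> R) : Prop :=
  forall (A : 'M[R]_(r, n)) (i j : 'I_r), i != j -> row i A = row j A -> f A = 0.

(* The values are in R^o so that preforms inherit the pointwise module
   structure of functions. *)
Definition preform (r n : nat) := 'rV[R]_n -> 'M[R]_(r, n) -> R^o.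

(* Extending forms by 0 outside U makes equality of forms on U Leibniz equality. *)
Definition is_form (r n : nat) (U : set 'rV[R]_n) (w : preform r n) : Prop :=
  [/\ forall x, ~ U x -> w x = 0,
      forall x, U x -> multilinear (w x) /\ alternating (w x) &
      forall v, smooth U (w^~ v)].

(* (dw)_x(v_0,...,v_r) = sum_i (-1)^i D_(v_i) (w(v_0,...,^v_i,...,v_r))(x), for
   constant vector fields v_i and without any 1/(r+1) factor. *)
Definition exterior (r n : nat) (U : set 'rV[R]_n) (w : preform r n) :
    preform r.+1 n := fun x v =>
  if x \in U then
    \sum_(i < r.+1) (-1) ^+ i * 'D_(row i v) (fun y => w y (row' i v)) x
  else 0.

(* (h^* w)_x(v_1,...,v_r) = w_(h x)(d_x h v_1,...,d_x h v_r) *)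
Definition pullback (r m n : nat) (h : 'rV[R]_m -> 'rV[R]_n) (w : preform r n) :
    preform r m := fun x v => w (h x) (v *m 'J h x).

Lemma is_form0 r n U : is_form U (0 : preform r n).
Proof.
split=> [//|x _|v k]; last exact: Ck_cst.
by split=> [i a b A B C _ _ _|//]; rewrite !mulr0 addr0.
Qed.

Lemma is_form_lin r n (U : set 'rV[R]_n) a (u v : preform r n) : open U ->
  is_form U u -> is_form U v -> is_form U (a *: u + v).
Proof.
move=> oU [u0 uM uS] [v0 vM vS]; split.
- by move=> x Ux; rewrite /= fctE /= fctE u0// v0// scaler0 addr0.
- move=> x Ux; have [mu au] := uM x Ux; have [mv av] := vM x Ux; split.
    move=> i b c A B C hA hB hC; rewrite !fctE.
    rewrite (mu i b c A B C)// (mv i b c A B C)// !scalerDr.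
    by rewrite ![a *: _]mulrCA !mulrDr [b * _ + _ + _]addrACA.
  by move=> A i j ij rA; rewrite !fctE (au A i j)// (av A i j)// scaler0 addr0.
- by move=> w k; apply: Ck_lin => //; [exact: uS|exact: vS].
Qed.

Lemma exterior_lin r n (U : set 'rV[R]_n) a (u v : preform r n) :
  is_form U u -> is_form U v ->
  exterior U (a *: u + v) = a *: exterior U u + exterior U v.
Proof.
move=> [_ _ uS] [_ _ vS]; apply/funext => x; apply/funext => w.
rewrite !fctE /exterior; case: ifPn => [|_]; last by rewrite scaler0 addr0.
rewrite inE => Ux; rewrite scaler_sumr -big_split /=; apply: eq_bigr => i _.
have du := diff_derivable (v := row i w) (Ck_diff (uS (row' i w) 1) Ux).
have dv := diff_derivable (v := row i w) (Ck_diff (vS (row' i w) 1) Ux).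
rewrite [X in _ * X](deriveD (derivableZ (k := a) du) dv) deriveZ//.
by rewrite mulrDr [in RHS]/GRing.scale /= mulrCA.
Qed.

End Forms.

(* Forms on a diffeological space and on a manifold are both families of forms
   on open subsets of Euclidean spaces, indexed by the plots of the diffeology
   and by the charts of the atlas respectively. *)
Record domains (R : realType) := Domains {
  didx :> Type;
  ddim : didx -> nat;
  ddom : forall i, set 'rV[R]_(ddim i);
  ddom_open : forall i, open (@ddom i) }.

Arguments ddom {R} d i : rename.

Section Family.
Variables (R : realType) (D : domains R).

Definition family (r : nat) := forall i : D, preform R r (ddim i).

Lemma family_ext r (u v : family r) : (forall i, u i = v i) -> u = v.
Proof. exact: functional_extensionality_dep. Qed.

Section lmod.
Variable r : nat.
HB.instance Definition _ := gen_eqMixin (family r).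
HB.instance Definition _ := gen_choiceMixin (family r).

Let add (u v : family r) : family r := fun i => u i + v i.
Let opp (u : family r) : family r := fun i => - u i.
Let scale (a : R) (u : family r) : family r := fun i => a *: u i.

Let addA : associative add.
Proof. by move=> u v w; apply: family_ext => i; exact: addrA. Qed.

Let addC : commutative add.
Proof. by move=> u v; apply: family_ext => i; exact: addrC. Qed.

Let add0 : left_id (fun=> 0) add.
Proof. by move=> u; apply: family_ext => i; exact: add0r. Qed.

Let addN : left_inverse (fun=> 0) opp add.
Proof. by move=> u; apply: family_ext => i; exact: addNr. Qed.

HB.instance Definition _ := GRing.isZmodule.Build (family r) addA addC add0 addN.

Let scaleA a b u : scale a (scale b u) = scale (a * b) u.
Proof. by apply: family_ext => i; exact: scalerA. Qed.

Let scale1 : left_id 1 scale.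
Proof. by move=> u; apply: family_ext => i; exact: scale1r. Qed.

Let scaleDr : right_distributive scale +%R.
Proof. by move=> a u v; apply: family_ext => i; exact: scalerDr. Qed.

Let scaleDl u : {morph scale^~ u : a b / a + b}.
Proof. by move=> a b; apply: family_ext => i; exact: scalerDl. Qed.

HB.instance Definition _ :=
  GRing.Zmodule_isLmodule.Build R (family r) scaleA scale1 scaleDr scaleDl.

End lmod.

Definition dfamily r (w : family r) : family r.+1 :=
  fun i => exterior (ddom D i) (w i).

Definition form_family r (w : family r) : Prop :=
  forall i, is_form (ddom D i) (w i).

Lemma form_family0 r : form_family (0 : family r).
Proof. by move=> i; exact: is_form0. Qed.

Lemma form_family_lin r a (u v : family r) :
  form_family u -> form_family v -> form_family (a *: u + v).
Proof. by move=> fu fv i; apply: is_form_lin => //; exact: ddom_open. Qed.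

Lemma dfamily_lin r a (u v : family r) :
  form_family u -> form_family v ->
  dfamily (a *: u + v) = a *: dfamily u + dfamily v.
Proof.
by move=> fu fv; apply: family_ext => i; exact: exterior_lin.
Qed.

Lemma dfamily0 r : dfamily (0 : family r) = 0.
Proof.
have := dfamily_lin (-1) (@form_family0 r) (@form_family0 r).
by rewrite scaler0 addr0 scaleN1r addNr.
Qed.

End Family.

Record plot (R : realType) (X : Type) := Plot {
  pdim : nat;
  pdom : set 'rV[R]_pdim;
  pdom_open : open pdom;
  pmap :> 'rV[R]_pdim -> X }.

Arguments pdom {R X} p : rename.
Arguments pdom_open {R X} p : rename.

Section Diffeology.
Variable R : realType.

Definition restrict_plot (X : Type) (a : plot R X) (V : set 'rV[R]_(pdim a))
    (oV : open V) : plot R X := Plot oV a.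

Definition map_plot (X Y : Type) (f : X -> Y) (a : plot R X) : plot R Y :=
  Plot (pdom_open a) (f \o a).

(* b = a \o h on the domain of b, with h smooth between the domains. *)
Definition reparametrizes (X : Type) (a b : plot R X)
    (h : 'rV[R]_(pdim b) -> 'rV[R]_(pdim a)) : Prop :=
  [/\ forall t, pdom b t -> pdom a (h t), smooth (pdom b) h &
      forall t, pdom b t -> b t = a (h t)].

Record diffeology (X : Type) := Diffeology {
  plots : set (plot R X);
  plots_const : forall a (x : X), (forall t, pdom a t -> a t = x) -> plots a;
  plots_comp : forall a b h, plots a -> @reparametrizes X a b h -> plots b;
  plots_local : forall a,
    (forall t, pdom a t -> exists (V : set 'rV[R]_(pdim a)) (oV : open V),
       [/\ V t, V `<=` pdom a & plots (restrict_plot oV)]) ->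
    plots a }.

Definition Ddifferentiable (X Y : Type) (D : diffeology X) (E : diffeology Y)
    (f : X -> Y) : Prop :=
  forall a, plots D a -> plots E (map_plot f a).

(* The least diffeology on Y for which f is differentiable. *)
Section Quotient.
Variables (X Y : Type) (D : diffeology X) (f : X -> Y).

Definition quotient_plots : set (plot R Y) :=
  [set a | forall E : diffeology Y, Ddifferentiable D E f -> plots E a].

Program Definition quotient_diffeology : diffeology Y :=
  @Diffeology Y quotient_plots _ _ _.
Next Obligation. by move=> a x ax E _; exact: (plots_const E ax). Qed.
Next Obligation. by move=> a b h Da hab E fE; exact: plots_comp (Da E fE) hab. Qed.
Next Obligation.
move=> a Ha E fE; apply: plots_local => t /Ha [V [oV [Vt Va Ea]]].
by exists V, oV; split=> //; exact: Ea.
Qed.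

Lemma Ddifferentiable_quotient : Ddifferentiable D quotient_diffeology f.
Proof. by move=> a Da E fE; exact: fE. Qed.

Lemma quotient_diffeology_least (E : diffeology Y) :
  Ddifferentiable D E f -> plots quotient_diffeology `<=` plots E.
Proof. by move=> fE a; apply. Qed.

End Quotient.

Section DForms.
Variables (X : Type) (D : diffeology X).

Definition plot_domains : domains R :=
  @Domains R {a : plot R X | plots D a} (fun a => pdim (sval a))
    (fun a => pdom (sval a)) (fun a => pdom_open (sval a)).

(* Taking h = id, two plots that agree on their common domain get the same form. *)
Definition is_Dform r (w : family plot_domains r) : Prop :=
  form_family w /\
  forall (a b : plot_domains) (h : 'rV[R]_(ddim b) -> 'rV[R]_(ddim a)),
    @reparametrizes X (sval a) (sval b) h ->
    forall t, ddom plot_domains b t -> w b t = pullback h (w a) t.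

Definition Dform_pred r : {pred family plot_domains r} :=
  fun w => `[< is_Dform w >].

Lemma Dform_submod r : submod_closed (@Dform_pred r).
Proof.
split=> [|k u v /asboolP[fu cu] /asboolP[fv cv]]; apply/asboolP; split.
- exact: form_family0.
- by [].
- exact: form_family_lin.
- move=> a b h hab t bt; apply/funext => z.
  rewrite /pullback /= [LHS]/(k *: u b t z + v b t z).
  by rewrite (cu _ _ _ hab _ bt) (cv _ _ _ hab _ bt).
Qed.

HB.instance Definition _ r := GRing.isSubmodClosed.Build R
  (family plot_domains r) (@Dform_pred r) (@Dform_submod r).

Lemma Dform_dlin r a : {in @Dform_pred r &, forall u v,
  dfamily (a *: u + v) = a *: dfamily u + dfamily v}.
Proof. by move=> u v /asboolP[fu _] /asboolP[fv _]; exact: dfamily_lin. Qed.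

Definition deRham_complex : precomplex R :=
  @Precomplex R (family plot_domains) (fun r => @Dform_pred r)
    (@dfamily R plot_domains) Dform_dlin.

End DForms.
End Diffeology.

Record chart (R : realType) (T : topologicalType) (n : nat) := Chart {
  cdom : set T;
  cimg : set 'rV[R]_n;
  cmap :> T -> 'rV[R]_n;
  cinv : 'rV[R]_n -> T;
  cdom_open : open cdom;
  cimg_open : open cimg;
  cmap_cimg : forall x, cdom x -> cimg (cmap x);
  cinv_cdom : forall z, cimg z -> cdom (cinv z);
  cmapK : forall x, cdom x -> cinv (cmap x) = x;
  cinvK : forall z, cimg z -> cmap (cinv z) = z;
  cmap_cont : forall x, cdom x -> {for x, continuous cmap};
  cinv_cont : forall z, cimg z -> {for z, continuous cinv} }.

Section Charts.
Variables (R : realType) (T : topologicalType) (n : nat).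
Implicit Types phi psi : chart R T n.

Definition overlap phi psi : set 'rV[R]_n :=
  [set z | cimg phi z /\ cdom psi (cinv phi z)].

Definition transition phi psi : 'rV[R]_n -> 'rV[R]_n := psi \o cinv phi.

Definition compatible phi psi : Prop :=
  smooth (overlap phi psi) (transition phi psi) /\
  smooth (overlap psi phi) (transition psi phi).

Lemma open_preimage_on (S S' : topologicalType) (A : set S) (f : S -> S') (B : set S') :
  open A -> open B -> (forall x, A x -> {for x, continuous f}) ->
  open (A `&` f @^-1` B).
Proof.
rewrite !openE => oA oB fc x [Ax Bx]; apply: filterI; first exact: oA.
by apply: fc => //; exact: oB.
Qed.

Lemma overlap_open phi psi : open (overlap phi psi).
Proof.
apply: open_preimage_on; [exact: cimg_open|exact: cdom_open|exact: cinv_cont].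
Qed.

End Charts.

Record manifold (R : realType) (n : nat) := Manifold {
  carrier :> topologicalType;
  manifold_hausdorff : hausdorff_space carrier;
  manifold_second_countable : @second_countable carrier;
  atlas : set (chart R carrier n);
  atlas_cover : forall x, exists2 phi, atlas phi & cdom phi x;
  atlas_compatible : forall phi psi, atlas phi -> atlas psi -> compatible phi psi;
  atlas_maximal : forall phi,
    (forall psi, atlas psi -> compatible phi psi) -> atlas phi }.

Section SmoothPlots.
Variables (R : realType) (n : nat) (M : manifold R n).

Definition smooth_plot (a : plot R M) : Prop :=
  (forall t, pdom a t -> {for t, continuous a}) /\
  forall phi, atlas phi -> smooth (pdom a `&` a @^-1` cdom phi) (phi \o a).

Program Definition smooth_diffeology : diffeology R M :=
  @Diffeology R M [set a | smooth_plot a] _ _ _.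
Next Obligation.
move=> a x ax; split.
  move=> t at_; rewrite /prop_for /continuous_at (ax t at_).
  have : nbhs t (pdom a) by apply: open_nbhs_nbhs; split=> //; exact: pdom_open.
  move=> ta; have atn : {near t, cst x =1 a}.
    by apply: filterS ta => y ay; rewrite (ax y ay).
  exact: cvg_trans (near_eq_cvg atn) (@cst_continuous _ _ x t).
move=> phi Aphi k.
have [dx|ndx] := pselect (cdom phi x); last first.
  have -> : pdom a `&` a @^-1` cdom phi = set0.
    by apply/seteqP; split=> // t [/ax at_]; rewrite /= at_ => /ndx.
  by elim: k (_ \o _) => [|k IH] f //=; split=> // v; exact: IH.
have -> : pdom a `&` a @^-1` cdom phi = pdom a.
  by apply/seteqP; split=> [t []//|t at_]; split=> //=; rewrite ax.
apply: (@eq_Ck _ _ _ _ _ (cst (phi x))); last exact: Ck_cst.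
  exact: pdom_open.
by move=> t /ax /= ->.
Qed.
Next Obligation.
move=> a b h [ac aS] [hU hS ba].
have hc t : pdom b t -> {for t, continuous h} by exact: hS 0 t.
split.
  move=> t bt; rewrite /prop_for /continuous_at (ba t bt).
  have : nbhs t (pdom b) by apply: open_nbhs_nbhs; split=> //; exact: pdom_open.
  move=> tb; have atn : {near t, a \o h =1 b}.
    by apply: filterS tb => y yb; rewrite (ba y yb).
  apply: cvg_trans (near_eq_cvg atn) _.
  by apply: (@continuous_comp _ _ _ h a); [exact: hc|exact: ac (hU t bt)].
move=> phi Aphi k.
have -> : pdom b `&` b @^-1` cdom phi =
    pdom b `&` h @^-1` (pdom a `&` a @^-1` cdom phi).
  apply/seteqP; split=> t [bt] /=; rewrite ba//; first by split=> //; split=> //; exact: hU.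
  by move=> [].
have oV : open (pdom b `&` h @^-1` (pdom a `&` a @^-1` cdom phi)).
  apply: open_preimage_on => //; first exact: pdom_open.
  apply: open_preimage_on => //; [exact: pdom_open|exact: cdom_open].
apply: (@eq_Ck _ _ _ _ _ ((phi \o a) \o h)) => //.
  by move=> t [bt _] /=; rewrite ba.
apply: (@Ck_comp _ _ _ _ _ _ (pdom a `&` a @^-1` cdom phi)) => //.
- by move=> t [].
- by apply: sub_Ck (hS k) => t [].
- exact: aS.
Qed.
Next Obligation.
move=> a H; split.
  by move=> t /H [V [oV [Vt Va [+ _]]]]; exact.
move=> phi Aphi k; apply: Ck_local => t [at_ pt].
have [V [oV [Vt Va [_ VS]]]] := H t at_.
exists V; split=> //; apply: sub_Ck (VS phi Aphi k) => y [[? ?] ?]; split=> //.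
Qed.

End SmoothPlots.

Section ManifoldForms.
Variables (R : realType) (n : nat) (M : manifold R n).

Definition chart_domains : domains R :=
  @Domains R {phi : chart R M n | atlas phi} (fun=> n)
    (fun phi => cimg (sval phi)) (fun phi => @cimg_open _ _ _ (sval phi)).

(* A form on M is given by its local expressions in the charts of the atlas, which
   are pullbacks of each other along the transition maps. *)
Definition mform r (w : family chart_domains r) : Prop :=
  form_family w /\ forall (phi psi : chart_domains) z, overlap (sval phi) (sval psi) z ->
    w phi z = pullback (transition (sval phi) (sval psi)) (w psi) z.

(* Likewise, a vector field is given by its components in the charts. *)
Record vfield := VField {
  vf : chart_domains -> 'rV[R]_n -> 'rV[R]_n;
  vf_smooth : forall phi : chart_domains, smooth (cimg (sval phi)) (vf phi);
  vf_compat : forall (phi psi : chart_domains) z,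
    overlap (sval phi) (sval psi) z ->
    vf psi (transition (sval phi) (sval psi) z) =
      vf phi z *m 'J (transition (sval phi) (sval psi)) z }.

(* i_X w = w(X, -, ..., -), and i_X f = 0 in degree 0. *)
Definition interior (X : vfield) r :
    family chart_domains r -> family chart_domains r.-1 :=
  match r with
  | 0 => fun _ => 0
  | s.+1 => fun w phi z v => w phi z (col_mx (vf X phi z) v)
  end.

Lemma interior_lin X r a (u v : family chart_domains r) :
  interior X (a *: u + v) = a *: interior X u + interior X v.
Proof. by case: r u v => [|r] u v //=; rewrite scaler0 addr0. Qed.

Lemma mform0 r : mform (0 : family chart_domains r).
Proof. by split=> //; exact: form_family0. Qed.

Lemma mform_lin r a (u v : family chart_domains r) :
  mform u -> mform v -> mform (a *: u + v).
Proof.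
move=> [fu cu] [fv cv]; split; first exact: form_family_lin.
move=> phi psi z Oz; apply/funext => w.
rewrite /pullback [LHS]/(a *: u phi z w + v phi z w).
by rewrite (cu _ _ _ Oz) (cv _ _ _ Oz).
Qed.

End ManifoldForms.

Section Foliations.
Variables (R : realType) (p q : nat).

(* A foliation with leaves of dimension p and codimension q, given by a foliated
   atlas: charts onto products A x B, with A connected, whose transition maps are
   locally of the form (x, y) |-> (g(x, y), h(y)).  The plaques are the subsets
   y = constant of the foliated charts. *)
Record foliation (M : manifold R (p + q)) := Foliation {
  fcharts : set (chart R M (p + q));
  fcharts_atlas : fcharts `<=` @atlas R (p + q) M;
  fcharts_cover : forall x, exists2 phi, fcharts phi & cdom phi x;
  fcharts_product : forall phi, fcharts phi ->
    exists (A : set 'rV[R]_p) (B : set 'rV[R]_q),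
      [/\ open A, open B, connected A &
          cimg phi = [set z | A (lsubmx z) /\ B (rsubmx z)]];
  fcharts_transition : forall phi psi, fcharts phi -> fcharts psi ->
    forall z, overlap phi psi z -> exists h : 'rV[R]_q -> 'rV[R]_q,
      \forall y \near z, rsubmx (transition phi psi y) = h (rsubmx y) }.

Variables (M : manifold R (p + q)) (F : foliation M).

Definition same_plaque (x y : M) : Prop :=
  exists phi, [/\ fcharts F phi, cdom phi x, cdom phi y &
    rsubmx (phi x) = rsubmx (phi y)].

(* Two points are on the same leaf iff a chain of plaques joins them. *)
Definition same_leaf (x y : M) : bool :=
  `[< clos_refl_sym_trans M same_plaque x y >].

Lemma same_leaf_equiv : equiv_class_of same_leaf.
Proof.
split.
- by move=> x; apply/asboolP; exact: rst_refl.
- by move=> x y; apply/asboolP/asboolP; exact: rst_sym.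
- by move=> y x z /asboolP xy /asboolP yz; apply/asboolP; exact: rst_trans xy yz.
Qed.

Canonical same_leaf_equiv_rel := EquivRelPack same_leaf_equiv.

Definition leaf_space := {eq_quot same_leaf}.

Definition leaf_proj : M -> leaf_space := \pi_leaf_space.

Definition leaf_diffeology : diffeology R leaf_space :=
  quotient_diffeology (smooth_diffeology M) leaf_proj.

Definition tangent (X : vfield M) : Prop :=
  forall phi : chart_domains M, fcharts F (sval phi) ->
  forall z, cimg (sval phi) z -> rsubmx (vf X phi z) = 0.

Definition is_basic r (w : family (chart_domains M) r) : Prop :=
  mform w /\ forall X, tangent X -> interior X w = 0 /\ interior X (dfamily w) = 0.

Definition basic_pred r : {pred family (chart_domains M) r} :=
  fun w => `[< is_basic w >].

Lemma basic_submod r : submod_closed (@basic_pred r).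
Proof.
split=> [|a u v /asboolP[fu bu] /asboolP[fv bv]]; apply/asboolP; split.
- exact: mform0.
- move=> X _; rewrite dfamily0.
  have i0 s : interior X (0 : family (chart_domains M) s) = 0.
    have := interior_lin X (-1) (0 : family (chart_domains M) s) 0.
    by rewrite scaler0 addr0 scaleN1r addNr.
  by rewrite !i0.
- exact: mform_lin.
- move=> X tX; have [u1 u2] := bu X tX; have [v1 v2] := bv X tX.
  rewrite dfamily_lin; [|exact: fu.1|exact: fv.1].
  by split; rewrite interior_lin ?u1 ?v1 ?u2 ?v2 scaler0 addr0.
Qed.

HB.instance Definition _ r := GRing.isSubmodClosed.Build R
  (family (chart_domains M) r) (@basic_pred r) (@basic_submod r).

Lemma basic_dlin r a : {in @basic_pred r &, forall u v,
  dfamily (a *: u + v) = a *: dfamily u + dfamily v}.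
Proof.
by move=> u v /asboolP[[fu _] _] /asboolP[[fv _] _]; exact: dfamily_lin.
Qed.

Definition basic_complex : precomplex R :=
  @Precomplex R (family (chart_domains M)) (fun r => @basic_pred r)
    (@dfamily R (chart_domains M)) basic_dlin.

Definition leaf_plot (a : plot R M) (sa : smooth_plot a) :
    plot_domains leaf_diffeology :=
  exist _ (map_plot leaf_proj a)
    (@Ddifferentiable_quotient _ _ _ (smooth_diffeology M) leaf_proj a sa).

(* theta = pi^* w: for every smooth plot a of M, a^* theta is the value of w at
   the plot pi \o a.  Since the inverses of charts are smooth plots, this
   determines theta. *)
Definition projection_pullback r (w : family (plot_domains leaf_diffeology) r)
    (theta : family (chart_domains M) r) : Prop :=
  forall (a : plot R M) (sa : smooth_plot a) (phi : chart_domains M) t,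
    pdom a t -> cdom (sval phi) (a t) ->
    w (leaf_plot sa) t = pullback (sval phi \o a) (theta phi) t.

End Foliations.

(* Main.v *)
From HB Require Import structures.
From mathcomp Require Import all_boot all_order all_algebra.
From mathcomp Require Import all_classical all_reals all_analysis.
From Stdlib Require Import Relation_Operators.
Require Import Defs.

Import Order.TTheory GRing.Theory Num.Theory numFieldNormedType.Exports.

Local Open Scope classical_set_scope.
Local Open Scope ring_scope.

(** The morphism is induced by the pullback pi^* along the projection
pi : M -> M/F.  The inverse of a chart phi is a smooth plot of M, so
pi \o phi^-1 is a plot of the leaf space, and the form that a
D-form w assigns to it is the local expression of pi^* w in phi
([leaf_pullback]).  Applying the invariance of w under reparametrization to
phi \o a, for a plot a of M, shows that a^* (pi^* w) is the value of w at
pi \o a ([leaf_pullbackP]); when a is the inverse of another chart, this says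
that the local expressions glue to a form on M.  Since d acts plot by plot on one
side and chart by chart on the other, pi^* commutes with d.

The point is that pi^* w is basic.  Let z = (x0, y0) be a point of the image
A x B of a foliated chart phi.  The map h (x, y) = (x0, y) slides each point
inside its plaque, so pi \o phi^-1 \o h = pi \o phi^-1, and invariance of w
gives pi^* w = h^* (pi^* w).  The differential of h kills the vectors tangent
to the plaques, hence the contraction of pi^* w with such a vector vanishes at
z, which h fixes ([leaf_pullback_horizontal]).  Arbitrary charts reduce to
foliated ones by the transition maps ([leaf_pullback_interior]).

The other half of being basic, i_X d (pi^* w) = 0, is the same statement for
dw, as d (pi^* w) = pi^* (dw); it therefore suffices that dw is again a D-form.
Passing to cohomology only involves forms for which this is given: a cocycle,
where dw = 0, and a primitive y of a cocycle w, where dy = w is a D-form.  The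
action of a map on cohomology is therefore constructed from its behaviour on
the cochains whose differential is a cochain ([cohomology_map]). *)

Lemma Ck_mulmxr {R : realType} {m n : nat} (P : 'M[R]_(m, n)) (k : nat)
    {U : set 'rV[R]_m} : open U -> Ck k U (fun z => z *m P).
Proof.
have cP : continuous (fun z : 'rV[R]_m => z *m P).
  (* z *m P is a sum of coordinates of z times constant rows. *)
  have : Ck 0 setT (fun z : 'rV[R]_m => \sum_i (z 0 i : R^o) *: row i P).
    apply: (@Ck_sum _ _ 'rV[R]_n); first exact: openT.
    move=> i z _; apply: continuousZ; last exact: cst_continuous.
    exact: coord_continuous.
  by rewrite (_ : (fun z => _) = mulmx^~ P) => [cP z|];
    [exact: cP|apply/funext => z; rewrite mulmx_sum_row].
move=> oU; case: k => [|k]; first by move=> x _; exact: cP.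
split=> [x _|v].
  exact: (@linear_differentiable _ _ _ (mulmxr P)).
rewrite (_ : (fun x => _) = cst (v *m P)); first exact: Ck_cst.
apply/funext => x; rewrite deriveE.
  by rewrite (@diff_lin _ _ _ (mulmxr P)).
exact: (@linear_differentiable _ _ _ (mulmxr P)).
Qed.

Lemma smooth_affine {R : realType} {m n : nat} (P : 'M[R]_(m, n))
    (c : 'rV[R]_n) {U : set 'rV[R]_m} :
  open U -> smooth U (fun z => z *m P + c).
Proof.
move=> oU k; have CP := Ck_mulmxr P k oU; have Cc := Ck_cst k U c.
by apply: eq_Ck oU _ (Ck_lin 1 oU CP Cc) => z _; rewrite scale1r.
Qed.

Lemma jacobian_affine {R : realType} {m n : nat} (P : 'M[R]_(m, n))
    (c : 'rV[R]_n) (z : 'rV[R]_m) :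
  jacobian (fun z => z *m P + c) z = P.
Proof.
have cP : continuous (mulmxr P : 'rV[R]_m -> 'rV[R]_n).
  by move=> x; exact: (Ck_mulmxr P 0 openT).
have dP : is_diff z (mulmxr P : 'rV[R]_m -> 'rV[R]_n) (mulmxr P).
  apply: DiffDef; last exact: diff_lin.
  exact: linear_differentiable.
have [_ dE] := is_diffD dP (is_diff_cst c z).
apply/row_matrixP => i; rewrite !rowE mul_rV_lin1.
have := congr1 (fun d => d (delta_mx 0 i)) dE.
by rewrite /= fctE addr0.
Qed.

Lemma smooth_id {R : realType} {n : nat} {U : set 'rV[R]_n} :
  open U -> smooth U id.
Proof.
move=> oU k; apply: eq_Ck oU _ (smooth_affine 1%:M 0 oU k) => z _.
by rewrite mulmx1 addr0.
Qed.

Lemma jacobian_id {R : realType} {n : nat} (z : 'rV[R]_n) :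
  jacobian id z = 1%:M.
Proof.
rewrite -[RHS](jacobian_affine 1%:M 0 z); congr (jacobian _ z).
by apply/funext => y; rewrite mulmx1 addr0.
Qed.

Lemma pullback_id {R : realType} {r n : nat} (w : preform R r n) z :
  pullback id w z = w z.
Proof. by apply/funext => v; rewrite /pullback jacobian_id mulmx1. Qed.

Lemma multilinear_row0 {R : realType} {r n : nat} {f : 'M[R]_(r, n) -> R}
    {A : 'M[R]_(r, n)} {i : 'I_r} : multilinear f -> row i A = 0 -> f A = 0.
Proof.
move=> mf A0; rewrite (mf i 0 0 A A A) ?mul0r ?addr0 //.
by rewrite A0 !scaler0 addr0.
Qed.

(** A linear map commuting with the differentials acts on cohomology as soon as
it sends to cochains those cochains whose differential is also a cochain; these
are the only ones met in comparing two representatives of a class. *)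
Section Functoriality.
Context {K : pzRingType} {C C' : precomplex K}.
Context (f : forall r, {linear ambient C r -> ambient C' r}).
Hypothesis f_differential : forall r (u : ambient C r),
  f r.+1 (differential u) = differential (f r u).
Hypothesis f_cochains : forall r (u : ambient C r),
  u \in cochains C r -> differential u \in cochains C r.+1 ->
  f r u \in cochains C' r.

Lemma cocycle_map_subproof {r} (z : cocycle C r) :
  f r (cocycle_val z) \in cocycle_pred (C := C') (r := r).
Proof.
have /andP[Cz /eqP dz] := cocycleP z.
rewrite inE -f_differential dz raddf0 eqxx andbT.
by apply: f_cochains => //; rewrite dz rpred0.
Qed.

Definition cocycle_map r (z : cocycle C r) : cocycle C' r :=
  Cocycle (cocycle_map_subproof z).

Lemma cocycle_map_linear r : linear (cocycle_map r).
Proof. by move=> a u v; apply: val_inj; rewrite /= !linearP. Qed.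

HB.instance Definition _ r := GRing.isLinear.Build K (cocycle C r)
  (cocycle C' r) _ (cocycle_map r) (cocycle_map_linear r).

Lemma coh_class_eqP (D : precomplex K) r (u v : cocycle D r) :
  coh_class u = coh_class v <-> coboundary (cocycle_val (u - v)).
Proof.
split=> [/eqmodP /asboolP //|uv].
by apply/eqmodP/asboolP.
Qed.

(** A primitive y of a cocycle has a differential that is a cochain, so it is
covered by [f_cochains]. *)
Lemma coboundary_map r (z : cocycle C r) :
  coboundary (cocycle_val z) -> coboundary (cocycle_val (cocycle_map r z)).
Proof.
have /andP[Cz _] := cocycleP z; rewrite /=.
case: r z Cz => [|r] z Cz /=; first by move=> ->; rewrite raddf0.
move=> [y Cy dy]; exists (f r y); last by rewrite -f_differential dy.
by apply: f_cochains => //; rewrite dy.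
Qed.

Definition cohomology_map r (x : cohomology C r) : cohomology C' r :=
  coh_class (cocycle_map r (repr x)).

Lemma cohomology_mapE r (z : cocycle C r) :
  cohomology_map r (coh_class z) = coh_class (cocycle_map r z).
Proof.
apply/coh_class_eqP; rewrite -raddfB; apply: coboundary_map.
by apply/coh_class_eqP; exact: reprK.
Qed.

Lemma cohomology_map_linear r : linear (cohomology_map r).
Proof.
move=> a x y; rewrite -[x]reprK -[y]reprK.
rewrite -[LHS]/(cohomology_map r (coh_scale a (coh_class _) + coh_class _)).
rewrite coh_scaleE -coh_classD !cohomology_mapE linearP coh_classD.
by rewrite -coh_scaleE.
Qed.

HB.instance Definition _ r := GRing.isLinear.Build K (cohomology C r)
  (cohomology C' r) _ (cohomology_map r) (cohomology_map_linear r).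
End Functoriality.

Section Projection.
Context {R : realType} {p q : nat} {M : manifold R (p + q)}.
Context (F : foliation M).

Definition chart_plot (phi : chart_domains M) : plot R M :=
  Plot (cimg_open (c := sval phi)) (cinv (sval phi)).

Lemma chart_plot_smooth (phi : chart_domains M) : smooth_plot (chart_plot phi).
Proof.
split=> [t|psi Apsi]; first exact: cinv_cont.
exact: (atlas_compatible (svalP phi) Apsi).1.
Qed.

(** The local expressions of pi^* w in the charts of M. *)
Definition leaf_pullback r (w : family (plot_domains (leaf_diffeology F)) r) :
    family (chart_domains M) r :=
  fun phi => w (leaf_plot F (chart_plot_smooth phi)).

Lemma leaf_pullback_linear r : linear (leaf_pullback r).
Proof. by []. Qed.

HB.instance Definition _ r := GRing.isLinear.Build R
  (family (plot_domains (leaf_diffeology F)) r) (family (chart_domains M) r) _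
  (leaf_pullback r) (leaf_pullback_linear r).

Lemma leaf_pullback_dfamily r (w : family (plot_domains (leaf_diffeology F)) r) :
  leaf_pullback r.+1 (dfamily w) = dfamily (leaf_pullback r w).
Proof. by []. Qed.

(** On the part of its domain that a maps into the chart phi, a is both a
restriction of itself and the reparametrization of phi^-1 by phi \o a.
Comparing the values of w along both gives the formula. *)
Lemma leaf_pullbackP r (w : family (plot_domains (leaf_diffeology F)) r) :
  is_Dform w -> projection_pullback w (leaf_pullback r w).
Proof.
move=> [_ cw] a sa phi t at_ pt.
have oV : open (pdom a `&` a @^-1` cdom (sval phi)).
  apply: open_preimage_on => //; [exact: pdom_open|exact: cdom_open|exact: sa.1].
pose b : plot R M := restrict_plot oV.
have rb : @reparametrizes R M a b id.
  by split=> //= [s []|] //; exact: smooth_id.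
have sb : smooth_plot b by exact: (plots_comp (d := smooth_diffeology M) sa rb).
(* Restricting a plot is reparametrizing it by the identity. *)
rewrite -[LHS]pullback_id.
rewrite -(cw (leaf_plot F sa) (leaf_plot F sb) id) //; last first.
  by split=> //= [s []|] //; exact: smooth_id.
apply: (cw (leaf_plot F (chart_plot_smooth phi)) (leaf_plot F sb)) => //.
split=> /= [s [_ ps]||s [_ ps]]; first exact: cmap_cimg.
  exact: (sa.2 _ (svalP phi)).
by rewrite cmapK.
Qed.

(** The gluing condition is [leaf_pullbackP] for the plots given by the inverses
of the charts. *)
Lemma leaf_pullback_mform r (w : family (plot_domains (leaf_diffeology F)) r) :
  is_Dform w -> mform (leaf_pullback r w).
Proof.
move=> Dw; split=> [phi|phi psi z [pz qz]].
  exact: Dw.1 (leaf_plot F (chart_plot_smooth phi)).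
exact: (leaf_pullbackP r w Dw (chart_plot phi) (chart_plot_smooth phi)).
Qed.

(** The plot pi \o phi^-1 is unchanged by h (x, y) = (x0, y), where
z = (x0, y0), because h preserves plaques.  So the value of w at it equals its
own pullback by h, which at the fixed point z replaces each row of v by its
transverse part; this makes row i vanish. *)
Lemma leaf_pullback_horizontal r (w : family (plot_domains (leaf_diffeology F)) r)
    (phi : chart_domains M) (z : 'rV[R]_(p + q)) (i : 'I_r)
    (v : 'M[R]_(r, p + q)) :
  is_Dform w -> fcharts F (sval phi) -> cimg (sval phi) z ->
  rsubmx (row i v) = 0 -> leaf_pullback r w phi z v = 0.
Proof.
move=> [fw cw] Fphi pz v0.
pose P : 'M[R]_(p + q) := block_mx 0 0 0 1%:M.
pose c : 'rV[R]_(p + q) := row_mx (lsubmx z) 0.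
pose h (y : 'rV[R]_(p + q)) := y *m P + c.
have mulP k (y : 'M[R]_(k, p + q)) : y *m P = row_mx 0 (rsubmx y).
  by rewrite -[y in LHS]hsubmxK mul_row_block !mulmx0 mulmx1 !add0r.
have hE y : h y = row_mx (lsubmx z) (rsubmx y).
  by rewrite /h mulP add_row_mx add0r addr0.
have hz : h z = z by rewrite hE hsubmxK.
(* The image of phi is a product, hence stable under h. *)
have hphi y : cimg (sval phi) y -> cimg (sval phi) (h y).
  have [A [B [_ _ _ AB]]] := fcharts_product Fphi.
  move: pz; rewrite AB /= => -[Az _] [_ By].
  by rewrite hE row_mxKl row_mxKr.
set a := leaf_plot F (chart_plot_smooth phi).
have rh : @reparametrizes R _ (sval a) (sval a) h.
  split=> //=; first exact/smooth_affine/cimg_open.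
  move=> y py; apply/eqmodP/asboolP/rst_step; exists (sval phi); split=> //.
  - exact: cinv_cdom.
  - exact/cinv_cdom/hphi.
  - by rewrite !cinvK //; [rewrite hE row_mxKr|exact: hphi].
rewrite /leaf_pullback -/a (cw a a h rh z pz) /pullback jacobian_affine hz.
have [_ /(_ z pz)[mw _] _] := fw a.
apply: (multilinear_row0 (i := i) mw).
by rewrite row_mul mulP v0 row_mx0.
Qed.

(** Tangency of X is a condition on its components in foliated charts, while phi
ranges over the whole atlas: the contraction is computed in a foliated chart psi
around the same point. *)
Lemma leaf_pullback_interior r (w : family (plot_domains (leaf_diffeology F)) r)
    (X : vfield M) :
  is_Dform w -> tangent F X -> interior X (leaf_pullback r w) = 0.
Proof.
move=> Dw tX; case: r w Dw => [//|r] w Dw.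
apply: family_ext => phi; apply/funext => z; apply/funext => v.
rewrite /interior [RHS]/=.
have [fw cw] := leaf_pullback_mform r.+1 w Dw.
have [pz|npz] := pselect (cimg (sval phi) z); last first.
  by have [w0 _ _] := fw phi; rewrite w0.
have [psi Fpsi xpsi] := fcharts_cover F (cinv (sval phi) z).
pose psi' : chart_domains M := exist _ psi (fcharts_atlas Fpsi).
have Oz : overlap (sval phi) (sval psi') z by [].
rewrite (cw phi psi' z Oz) /pullback.
apply: (leaf_pullback_horizontal r.+1 w psi' _ (@lshift 1 r 0)) => //.
  exact: cmap_cimg.
rewrite row_mul.
have -> : row (@lshift 1 r 0) (col_mx (vf X phi z) v) = vf X phi z.
  by rewrite (@rowKu _ 1 r) row_id.
rewrite -(vf_compat X Oz).
by apply: tX => //; exact: cmap_cimg.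
Qed.

Lemma leaf_pullback_basic r (w : family (plot_domains (leaf_diffeology F)) r) :
  is_Dform w -> is_Dform (dfamily w) -> is_basic F (leaf_pullback r w).
Proof.
move=> Dw Ddw; split=> [|X tX]; first exact: leaf_pullback_mform.
split; first exact: leaf_pullback_interior.
rewrite -leaf_pullback_dfamily; exact: leaf_pullback_interior.
Qed.

End Projection.

Theorem theorem4p1 (R : realType) (p q : nat) (M : manifold R (p + q))
    (F : foliation M) :
  exists Phi : forall r : nat,
      {linear cohomology (deRham_complex (leaf_diffeology F)) r ->
              cohomology (basic_complex F) r},
    forall (r : nat) (w : cocycle (deRham_complex (leaf_diffeology F)) r),
      exists2 theta : cocycle (basic_complex F) r,
        projection_pullback (cocycle_val w) (cocycle_val theta) &
        Phi r (coh_class w) = coh_class theta.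
Proof.
pose f r : {linear ambient (deRham_complex (leaf_diffeology F)) r ->
    ambient (basic_complex F) r} := leaf_pullback F r.
have fd r u : f r.+1 (differential u) = differential (f r u) by [].
have fC r (u : ambient (deRham_complex (leaf_diffeology F)) r) :
    u \in cochains (deRham_complex (leaf_diffeology F)) r ->
    differential u \in cochains (deRham_complex (leaf_diffeology F)) r.+1 ->
    f r u \in cochains (basic_complex F) r.
  by move=> /asboolP Du /asboolP Ddu; apply/asboolP; exact: leaf_pullback_basic.
exists (fun r => cohomology_map f fd fC r) => r w.
exists (cocycle_map f fd fC r w); last exact: cohomology_mapE.
apply: leaf_pullbackP.
by have /andP[/asboolP] := cocycleP w.
Qed.
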